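(* Let $0\leq m_r\leq d_r$, $0\leq m_f\leq d_f$ satisfy $d_r\geq d_f-m_f$, $d_f\geq d_r-m_r$, and let $0\leq m_r'\leq d_r'$, $0\leq m_f'\leq d_f'$ satisfy $d_r'\geq d_f'-m_f'$, $d_f'\geq d_r'-m_r'$. The following are equivalent: (i) for every $u\in S$, $Sol_{BDC}^{m_r,d_r,m_f,d_f}(u)\subset Sol_{BDC}^{m_r',d_r',m_f',d_f'}(u)$; (ii) $d_r'-m_r'\leq d_r-m_r\leq d_f\leq d_f'$ and $d_f'-m_f'\leq d_f-m_f\leq d_r\leq d_r'$.
   Context: $\mathbf{B}=\{0,1\}$ with Boolean operations, ordered by $0<1$. $S$ is the set of signals: functions $x:\mathbb{R}\to\mathbf{B}$ for which there is a strictly increasing unbounded sequence $t_0<t_1<t_2<\dots$ of reals such that $x$ is constant on $(-\infty,t_0)$ and on each $[t_k,t_{k+1})$. For a bounded interval $I$ and $u\in S$, $\bigcap_{\xi\in I}u(\xi)$ equals $1$ iff $u(\xi)=1$ for all $\xi\in I$, and $\bigcup_{\xi\in I}u(\xi)$ equals $1$ iff $u(\xi)=1$ for some $\xi\in I$. For $0\leq m_r\leq d_r$, $0\leq m_f\leq d_f$ and $u\in S$, $Sol_{BDC}^{m_r,d_r,m_f,d_f}(u)$ is the set of $x\in S$ such that for all $t\in\mathbb{R}$: $\bigcap_{\xi\in[t-d_r,t-d_r+m_r]}u(\xi)\leq x(t)\leq\bigcup_{\xi\in[t-d_f,t-d_f+m_f]}u(\xi)$. *)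

(* Defs.v *)
From HB Require Import structures.
From mathcomp Require Import all_boot all_order all_algebra.
From mathcomp Require Import all_classical all_reals.
Set Implicit Arguments.
Unset Strict Implicit.
Unset Printing Implicit Defensive.
Import Order.TTheory GRing.Theory Num.Theory.
Local Open Scope classical_set_scope.
Local Open Scope ring_scope.

Definition signal (R : realType) : set (R -> bool) :=
  [set x | exists t : nat -> R,
    [/\ forall k, t k < t k.+1,
        forall M : R, exists k, M < t k,
        forall s s', s < t 0%N -> s' < t 0%N -> x s = x s' &
        forall k s s', t k <= s < t k.+1 -> t k <= s' < t k.+1 -> x s = x s'] ].

Definition bcap (R : realType) (I : set R) (u : R -> bool) : bool :=
  `[< forall xi, I xi -> u xi = true >].

Definition bcup (R : realType) (I : set R) (u : R -> bool) : bool :=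
  `[< exists xi, I xi /\ u xi = true >].

(* The order on bool is the library's one, with false < true. *)
Definition Sol_BDC (R : realType) (mr dr mf df : R) (u : R -> bool) :
    set (R -> bool) :=
  [set x | signal x /\
    forall t : R,
      (bcap `[t - dr, t - dr + mr] u <= x t)%O /\
      (x t <= bcup `[t - df, t - df + mf] u)%O].

(* Main.v *)
Require Import Defs.
From mathcomp Require Import all_boot all_order all_algebra.
From mathcomp Require Import all_classical all_reals.
From mathcomp Require Import lra.
Import Order.TTheory GRing.Theory Num.Theory.
Local Open Scope classical_set_scope.
Local Open Scope ring_scope.

(** The step jumping from [0] to [1] at time [a + c] is a solution for the input
    step jumping at time [a] exactly when the delay [c] lies in [[df - mf, dr]].
    Complementing inputs and outputs exchanges the roles of rising and falling,
    so for falling steps the possible delays are those in [[dr - mr, df]].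
    Thus (i) forces these two intervals into their primed counterparts, which is
    (ii).  Conversely these inclusions say that the windows of the second system
    contain those of the first, and intersections decrease while unions increase
    with the window. *)

Section BoundedDelayCondition.
Set Implicit Arguments.
Unset Strict Implicit.
Variable R : realType.
Implicit Types (I J : set R) (u x : R -> bool).
Implicit Types a c p q t m d mr dr mf df : R.

Lemma le_boolP (b b' : bool) : reflect (b -> b') (b <= b')%O.
Proof. by case: b; case: b'; constructor=> // /(_ isT). Qed.

Lemma negb_compK (T : Type) (u : T -> bool) : negb \o (negb \o u) = u.
Proof. by apply/funext => s /=; rewrite negbK. Qed.

Lemma signal_comp (f : bool -> bool) x : signal x -> signal (f \o x).
Proof.
case=> t [t_incr t_unbounded x_initial x_step]; exists t; split=> //=.
  by move=> s s' s_lt s'_lt; congr f; exact: x_initial.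
by move=> k s s' s_in s'_in; congr f; exact: x_step s_in s'_in.
Qed.

Lemma bcap_subset I J u : I `<=` J -> (bcap J u <= bcap I u)%O.
Proof.
move=> IJ; apply/le_boolP => /asboolP uJ.
by apply/asboolP => s /IJ/uJ.
Qed.

Lemma bcup_subset I J u : I `<=` J -> (bcup I u <= bcup J u)%O.
Proof.
move=> IJ; apply/le_boolP => /asboolP[s [/IJ Js us]].
by apply/asboolP; exists s.
Qed.

Lemma bcapN I u : bcap I (negb \o u) = ~~ bcup I u.
Proof.
rewrite /bcap /bcup -asbool_neg; apply: asbool_equiv_eq.
split=> [uN [s [Is us]]|uN s Is /=]; first by have /= := uN s Is; rewrite us.
by apply/negP => us; apply: uN; exists s.
Qed.

Lemma bcupN I u : bcup I (negb \o u) = ~~ bcap I u.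
Proof. by rewrite -[u in RHS]negb_compK bcapN negbK. Qed.

Lemma Sol_BDCN mr dr mf df u x :
  Sol_BDC mr dr mf df (negb \o u) (negb \o x) <-> Sol_BDC mf df mr dr u x.
Proof.
suff complement mr' dr' mf' df' v y : Sol_BDC mf' df' mr' dr' v y ->
    Sol_BDC mr' dr' mf' df' (negb \o v) (negb \o y).
  by split; [move/complement; rewrite !negb_compK|exact: complement].
case=> y_signal y_bounds; split; first exact: signal_comp.
move=> t; have [lower upper] := y_bounds t.
by rewrite bcapN bcupN !Order.CTBDistrLatticeTheory.leC.
Qed.

Lemma window_subset m d m' d' t :
  d' - m' <= d - m -> d <= d' ->
  `[t - d, t - d + m] `<=` `[t - d', t - d' + m'].
Proof. by move=> end_le start_le; apply: subset_itv; rewrite bnd_simp; lra. Qed.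

Lemma Sol_BDC_subset mr dr mf df mr' dr' mf' df' u :
  dr' - mr' <= dr - mr -> dr <= dr' -> df' - mf' <= df - mf -> df <= df' ->
  Sol_BDC mr dr mf df u `<=` Sol_BDC mr' dr' mf' df' u.
Proof.
move=> r_end r_start f_end f_start x [x_signal x_bounds]; split=> // t.
have [lower upper] := x_bounds t; split.
  exact: le_trans (bcap_subset u (window_subset r_end r_start)) lower.
exact: le_trans upper (bcup_subset u (window_subset f_end f_start)).
Qed.

Definition step c : R -> bool := fun s => c <= s.

Lemma signal_step c : signal (step c).
Proof.
exists (fun k => c + k%:R); split.
- by move=> k; rewrite ltrD2l ltr_nat.
- by move=> M; exists (Num.trunc (M - c)).+1; rewrite -ltrBlDl truncnS_gt.
- by move=> s s'; rewrite /step addr0 !leNgt => -> ->.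
- have step_after k s : c + k%:R <= s < c + k.+1%:R -> step c s.
    by case/andP=> + _; apply: le_trans; rewrite lerDl.
  by move=> k s s' /step_after -> /step_after ->.
Qed.

Lemma bcap_itv_step c p q : p <= q -> bcap `[p, q] (step c) = (c <= p).
Proof.
move=> pq; apply/asboolP/idP => [|cp s].
  by apply; rewrite /= in_itv /= lexx.
by rewrite /= in_itv /= => /andP[ps _]; exact: le_trans ps.
Qed.

Lemma bcup_itv_step c p q : p <= q -> bcup `[p, q] (step c) = (c <= q).
Proof.
move=> pq; apply/asboolP/idP => [[s []]|cq].
  by rewrite /= in_itv /= => /andP[_ sq] cs; exact: le_trans sq.
by exists q; rewrite /= in_itv /= lexx andbT.
Qed.

Lemma Sol_BDC_step mr dr mf df a c : 0 <= mr -> 0 <= mf ->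
  Sol_BDC mr dr mf df (step a) (step (a + c)) <-> df - mf <= c <= dr.
Proof.
move=> mr_ge0 mf_ge0; split=> [[_ bounds]|/andP[c_lower c_upper]].
- apply/andP; split.
  + have [_ /le_boolP] := bounds (a + c).
    by rewrite bcup_itv_step ?lerDl // /step lexx => /(_ isT); lra.
  + have [/le_boolP + _] := bounds (a + dr).
    by rewrite bcap_itv_step ?lerDl // /step addrK lexx => /(_ isT); lra.
- split=> [|t]; first exact: signal_step.
  split; apply/le_boolP.
  + by rewrite bcap_itv_step ?lerDl // /step; lra.
  + by rewrite bcup_itv_step ?lerDl // /step; lra.
Qed.

Lemma Sol_BDC_step_subset_le mr dr mf df mr' dr' mf' df' a :
  0 <= mr -> 0 <= mf -> 0 <= mr' -> 0 <= mf' -> df - mf <= dr ->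
  Sol_BDC mr dr mf df (step a) `<=` Sol_BDC mr' dr' mf' df' (step a) ->
  df' - mf' <= df - mf /\ dr <= dr'.
Proof.
move=> mr_ge0 mf_ge0 mr'_ge0 mf'_ge0 delay_range Sol_sub.
have delay_sub c : df - mf <= c <= dr -> df' - mf' <= c <= dr'.
  by move/(Sol_BDC_step _ _ a _ mr_ge0 mf_ge0)/Sol_sub/Sol_BDC_step->.
have /andP[-> _] : df' - mf' <= df - mf <= dr' by rewrite delay_sub ?lexx.
by have /andP[_ ->] : df' - mf' <= dr <= dr' by rewrite delay_sub ?lexx ?andbT.
Qed.

End BoundedDelayCondition.

Theorem theorem1p4 (R : realType) (mr dr mf df mr' dr' mf' df' : R)
  (hr : 0 <= mr <= dr) (hf : 0 <= mf <= df)
  (hrf : dr >= df - mf) (hfr : df >= dr - mr)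
  (hr' : 0 <= mr' <= dr') (hf' : 0 <= mf' <= df')
  (hrf' : dr' >= df' - mf') (hfr' : df' >= dr' - mr') :
  (forall u : R -> bool, signal u ->
     Sol_BDC mr dr mf df u `<=` Sol_BDC mr' dr' mf' df' u)
  <->
  ((dr' - mr' <= dr - mr /\ dr - mr <= df /\ df <= df') /\
   (df' - mf' <= df - mf /\ df - mf <= dr /\ dr <= dr')).
Proof.
have [/andP[mr_ge0 _] /andP[mf_ge0 _]] := (hr, hf).
have [/andP[mr'_ge0 _] /andP[mf'_ge0 _]] := (hr', hf').
split=> [Sol_sub|[[r_end [_ f_start]] [f_end [_ r_start]]] u _]; last first.
  exact: Sol_BDC_subset.
have rise_sub := Sol_sub _ (signal_step 0).
have fall_sub :
    Sol_BDC mf df mr dr (step 0) `<=` Sol_BDC mf' df' mr' dr' (step 0).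
  have fall_signal : signal (negb \o step (0 : R)).
    exact/signal_comp/signal_step.
  by move=> x /Sol_BDCN/(Sol_sub _ fall_signal)/Sol_BDCN.
have [f_end r_start] :=
  Sol_BDC_step_subset_le mr_ge0 mf_ge0 mr'_ge0 mf'_ge0 hrf rise_sub.
have [r_end f_start] :=
  Sol_BDC_step_subset_le mf_ge0 mr_ge0 mf'_ge0 mr'_ge0 hfr fall_sub.
by [].
Qed.
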